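(* Let $R$ be a ring. Then the following are equivalent. (1) $R$ is right coherent. (2) The standard $t$-structure of $\mathcal{D}(\mathsf{Mod}\text{-}R)$ restricts to $\mathcal{K}^{-}(\mathsf{proj}\text{-}R)$. (3) The standard $t$-structure of $\mathcal{D}(\mathsf{Mod}\text{-}R)$ restricts to $\mathcal{K}^{-,b}(\mathsf{proj}\text{-}R)$.
   Context: $\mathcal{D}(\mathsf{Mod}\text{-}R)$ is the unbounded derived category of all right $R$-modules. $\mathsf{proj}\text{-}R$ is the category of finitely generated projective right $R$-modules. $\mathcal{K}^{-}(\mathsf{proj}\text{-}R)$ is the homotopy category of bounded-above (cochain) complexes over $\mathsf{proj}\text{-}R$, and $\mathcal{K}^{-,b}(\mathsf{proj}\text{-}R)$ is its full subcategory of complexes with only finitely many non-zero cohomology groups; both are regarded as full triangulated subcategories of $\mathcal{D}(\mathsf{Mod}\text{-}R)$ (closed under isomorphism). The standard $t$-structure is $(\mathcal{D}^{\leq 0},\mathcal{D}^{\geq 0})$ with $\mathcal{D}^{\leq 0}=\{X: H^i(X)=0\ \forall i>0\}$, $\mathcal{D}^{\geq 0}=\{X:H^i(X)=0\ \forall i<0\}$. A $t$-structure $(t^{\leq 0},t^{\geq 0})$ restricts to a triangulated subcategory $\mathscr{U}$ if $(t^{\leq 0}\cap\mathscr{U},t^{\geq 0}\cap\mathscr{U})$ is a $t$-structure on $\mathscr{U}$. A ring is right coherent if the kernel of every morphism between finitely generated projective right modules is finitely generated. *)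

(* Defs.v *)
From HB Require Import structures.
From mathcomp Require Import all_boot all_order all_algebra.

Set Implicit Arguments.
Unset Strict Implicit.
Unset Printing Implicit Defensive.

Import Order.TTheory GRing.Theory Num.Theory.
Local Open Scope ring_scope.

(** * Right modules

    A right [R]-module is a left module over the converse ring [R^c]; the
    scaling [a *: x] on an [lmodType R^c] is the right multiplication of [x]
    by [a]. *)

Notation rmodType R := (lmodType R^c).

Definition fg_submodule (R : pzRingType) (M : rmodType R) (K : M -> Prop) :
    Prop :=
  exists (n : nat) (g : 'I_n -> M),
    (forall k, K (g k)) /\
    (forall x, K x -> exists c : 'I_n -> R^c, x = \sum_(k < n) c k *: g k).

Definition finitely_generated (R : pzRingType) (M : rmodType R) : Prop :=
  fg_submodule (fun _ : M => True).

Definition projective (R : pzRingType) (P : rmodType R) : Prop :=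
  forall (A B : rmodType R) (p : {linear A -> B}) (f : {linear P -> B}),
    (forall b, exists a, p a = b) ->
    exists h : {linear P -> A}, forall x, p (h x) = f x.

Definition fgproj (R : pzRingType) (P : rmodType R) : Prop :=
  finitely_generated P /\ projective P.

Definition right_coherent (R : pzRingType) : Prop :=
  forall (P Q : rmodType R) (f : {linear P -> Q}),
    fgproj P -> fgproj Q -> fg_submodule (fun x : P => f x = 0).

(** * Cochain complexes

    Degrees are integers.  The successor of a degree is computed by cases, so
    that it reduces on constructors; it is [i + 1]. *)

Definition succz (i : int) : int :=
  match i with
  | Posz n => Posz n.+1
  | Negz 0 => Posz 0
  | Negz n.+1 => Negz n
  end.

Lemma succzE (i : int) : succz i = i + 1.
Proof.
case: i => [n|[|n]] //=; first by rewrite intS addrC.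
by rewrite !NegzE [in RHS]intS opprD addrAC addNr add0r.
Qed.

Lemma succz_inj : injective succz.
Proof. by move=> i j; rewrite !succzE => /addIr. Qed.

Record complex (R : pzRingType) := Complex {
  obj :> int -> rmodType R;
  diff : forall i, {linear obj i -> obj (succz i)};
  diffK : forall i (x : obj i), diff (succz i) (diff i x) = 0 }.

Definition cocycle (R : pzRingType) (X : complex R) (i : int) (x : X i) : Prop :=
  diff X i x = 0.

(* [coboundary x], for [x] of degree [i], says that [x] is in the image of the
   differential ending in degree [i]; presenting it as an indexed family avoids
   transporting along [succz (i - 1) = i]. *)
Inductive coboundary (R : pzRingType) (X : complex R) :
    forall i : int, X i -> Prop :=
  | Coboundary (j : int) (y : X j) : coboundary (diff X j y).

Lemma coboundary_inv (R : pzRingType) (X : complex R) i (x : X i) :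
  coboundary x ->
  exists k (e : succz k = i) (y : X k), x = ecast k (X k) e (diff X k y).
Proof. by case=> j y; exists j, erefl, y. Qed.

(* [H^i(X) = 0] *)
Definition cohomology_zero (R : pzRingType) (X : complex R) (i : int) : Prop :=
  forall x : X i, cocycle x -> coboundary x.

Record chain_map (R : pzRingType) (X Y : complex R) := ChainMap {
  chain_fun :> forall i, {linear X i -> Y i};
  chain_funC : forall i (x : X i),
    chain_fun (succz i) (diff X i x) = diff Y i (chain_fun i x) }.

Lemma chain_id_subproof (R : pzRingType) (X : complex R) i (x : X i) :
  (idfun : {linear X (succz i) -> X (succz i)}) (diff X i x)
  = diff X i ((idfun : {linear X i -> X i}) x).
Proof. by []. Qed.

Definition chain_id (R : pzRingType) (X : complex R) : chain_map X X :=
  ChainMap (@chain_id_subproof R X).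

Lemma chain_comp_subproof (R : pzRingType) (X Y Z : complex R)
    (g : chain_map Y Z) (f : chain_map X Y) i (x : X i) :
  (g (succz i) \o f (succz i) : {linear X (succz i) -> Z (succz i)}) (diff X i x)
  = diff Z i ((g i \o f i : {linear X i -> Z i}) x).
Proof. by rewrite /= !chain_funC. Qed.

Definition chain_comp (R : pzRingType) (X Y Z : complex R)
    (g : chain_map Y Z) (f : chain_map X Y) : chain_map X Z :=
  ChainMap (chain_comp_subproof g f).

Lemma chain_zero_subproof (R : pzRingType) (X Y : complex R) i (x : X i) :
  (\0 : {linear X (succz i) -> Y (succz i)}) (diff X i x)
  = diff Y i ((\0 : {linear X i -> Y i}) x).
Proof. by rewrite /= linear0. Qed.

Definition chain_zero (R : pzRingType) (X Y : complex R) : chain_map X Y :=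
  ChainMap (@chain_zero_subproof R X Y).

(* The maps induced by [f] on cohomology are injective and surjective. *)
Definition quasi_iso (R : pzRingType) (X Y : complex R) (f : chain_map X Y) :
    Prop :=
  forall i,
    (forall x : X i, cocycle x -> coboundary (f i x) -> coboundary x) /\
    (forall y : Y i, cocycle y ->
       exists x : X i, cocycle x /\ coboundary (y - f i x)).

(** ** Shift: [X[1]^i = X^(i+1)] with differential [- d] *)

Lemma shift_subproof (R : pzRingType) (X : complex R) i (x : X (succz i)) :
  (\- diff X (succz (succz i)) :
     {linear X (succz (succz i)) -> X (succz (succz (succz i)))})
    ((\- diff X (succz i) : {linear X (succz i) -> X (succz (succz i))}) x) = 0.
Proof. by rewrite /= linearN opprK diffK. Qed.

Definition shift (R : pzRingType) (X : complex R) : complex R :=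
  @Complex R (fun i => X (succz i)) (fun i => \- diff X (succz i))
    (@shift_subproof R X).

Lemma shift_map_subproof (R : pzRingType) (X Y : complex R)
    (f : chain_map X Y) i (x : shift X i) :
  f (succz (succz i)) (diff (shift X) i x) = diff (shift Y) i (f (succz i) x).
Proof. by rewrite /= linearN chain_funC. Qed.

Definition shift_map (R : pzRingType) (X Y : complex R) (f : chain_map X Y) :
    chain_map (shift X) (shift Y) :=
  @ChainMap R (shift X) (shift Y) (fun i => f (succz i))
    (shift_map_subproof f).

Lemma shift_cocycle (R : pzRingType) (X : complex R) i (x : shift X i) :
  cocycle x <-> @cocycle R X (succz i) x.
Proof.
rewrite /cocycle /=; split=> [/eqP|->]; last by rewrite oppr0.
by rewrite oppr_eq0 => /eqP.
Qed.

Lemma shift_coboundary (R : pzRingType) (X : complex R) i (x : shift X i) :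
  coboundary x <-> @coboundary R X (succz i) x.
Proof.
split=> [|H].
  by case=> j y /=; rewrite -linearN; apply: Coboundary.
case/coboundary_inv: H => k [e [y ->]]; have ek := succz_inj e; case: _ / ek e y => {x} e y.
rewrite (eq_axiomK e) /=.
suff [j ej] : exists j, succz j = k.
  case: _ / ej e y => e y.
  have -> : diff X (succz j) y = diff (shift X) j (- y).
    by rewrite /= linearN opprK.
  exact: Coboundary.
by exists (k - 1); rewrite succzE subrK.
Qed.

Lemma shift_quasi_iso (R : pzRingType) (X Y : complex R) (f : chain_map X Y) :
  quasi_iso f -> quasi_iso (shift_map f).
Proof.
move=> qf i; have [inj surj] := qf (succz i); split=> [x|y].
  move=> /shift_cocycle cx /shift_coboundary bx.
  by apply/shift_coboundary/inj.
move=> /shift_cocycle /surj [x [cx bx]].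
by exists x; split; [apply/shift_cocycle|apply/shift_coboundary].
Qed.

(** ** Mapping cone: [C(f)^i = X^(i+1) (+) Y^i] with differential
    [(x, y) |-> (- d x, f x + d y)] *)

Definition cone_diff (R : pzRingType) (X Y : complex R) (f : chain_map X Y)
    (i : int) (p : (X (succz i) * Y i)%type) :
    (X (succz (succz i)) * Y (succz i))%type :=
  (- diff X (succz i) p.1, f (succz i) p.1 + diff Y i p.2).

Lemma cone_diff_linear (R : pzRingType) (X Y : complex R) (f : chain_map X Y)
    (i : int) : linear (cone_diff f (i := i)).
Proof.
move=> a [x1 y1] [x2 y2]; rewrite /cone_diff /=; congr (_, _) => /=.
  by rewrite linearP opprD scalerN.
by rewrite !linearP /= scalerDr addrACA.
Qed.

HB.instance Definition _ (R : pzRingType) (X Y : complex R)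
    (f : chain_map X Y) (i : int) :=
  GRing.isLinear.Build R^c (X (succz i) * Y i)%type
    (X (succz (succz i)) * Y (succz i))%type *:%R (@cone_diff R X Y f i)
    (cone_diff_linear f (i := i)).

Lemma cone_subproof (R : pzRingType) (X Y : complex R) (f : chain_map X Y) i
    (p : (X (succz i) * Y i)%type) : cone_diff f (cone_diff f p) = 0.
Proof.
rewrite /cone_diff /=; congr (_, _).
  by rewrite linearN opprK diffK.
by rewrite linearN linearD diffK addr0 chain_funC addNr.
Qed.

Definition cone (R : pzRingType) (X Y : complex R) (f : chain_map X Y) :
    complex R :=
  @Complex R (fun i => (X (succz i) * Y i)%type)
    (fun i => @cone_diff R X Y f i) (@cone_subproof R X Y f).

Definition cone_in (R : pzRingType) (X Y : complex R) (f : chain_map X Y)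
    (i : int) (y : Y i) : (X (succz i) * Y i)%type := (0, y).

Lemma cone_in_linear (R : pzRingType) (X Y : complex R) (f : chain_map X Y)
    (i : int) : linear (@cone_in R X Y f i).
Proof. by move=> a y1 y2; congr (_, _); rewrite /= scaler0 addr0. Qed.

HB.instance Definition _ (R : pzRingType) (X Y : complex R)
    (f : chain_map X Y) (i : int) :=
  GRing.isLinear.Build R^c (Y i) (X (succz i) * Y i)%type *:%R
    (@cone_in R X Y f i) (@cone_in_linear R X Y f i).

Lemma cone_inl_subproof (R : pzRingType) (X Y : complex R)
    (f : chain_map X Y) i (y : Y i) :
  @cone_in R X Y f (succz i) (diff Y i y) = diff (cone f) i (@cone_in R X Y f i y).
Proof. by rewrite /= /cone_diff /cone_in /= !linear0 add0r. Qed.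

Definition cone_incl (R : pzRingType) (X Y : complex R) (f : chain_map X Y) :
    chain_map Y (cone f) :=
  @ChainMap R Y (cone f) (fun i => @cone_in R X Y f i)
    (@cone_inl_subproof R X Y f).

Lemma cone_proj_subproof (R : pzRingType) (X Y : complex R)
    (f : chain_map X Y) i (p : cone f i) :
  (fst : {linear (X (succz (succz i)) * Y (succz i))%type -> X (succz (succz i))})
    (diff (cone f) i p)
  = diff (shift X) i ((fst : {linear (X (succz i) * Y i)%type -> X (succz i)}) p).
Proof. by []. Qed.

Definition cone_proj (R : pzRingType) (X Y : complex R) (f : chain_map X Y) :
    chain_map (cone f) (shift X) :=
  @ChainMap R (cone f) (shift X)
    (fun i => (fst : {linear (X (succz i) * Y i)%type -> X (succz i)}))
    (@cone_proj_subproof R X Y f).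

(** * The unbounded derived category

    [D(Mod-R)] is the localization of the category of all cochain complexes of
    right [R]-modules at the quasi-isomorphisms: its objects are the complexes,
    its morphisms are the formal composites of chain maps and of formal
    inverses of quasi-isomorphisms ([dhom]), modulo the congruence [deq]
    generated by the category laws, the functoriality of the localization
    functor [Dmap] and the inversion of quasi-isomorphisms. *)

Inductive dhom (R : pzRingType) : complex R -> complex R -> Type :=
  | Dmap X Y (f : chain_map X Y) : dhom X Y
  | Dinv X Y (s : chain_map X Y) (qs : quasi_iso s) : dhom Y X
  | Dcomp X Y Z (g : dhom Y Z) (f : dhom X Y) : dhom X Z.

Definition did (R : pzRingType) (X : complex R) : dhom X X := Dmap (chain_id X).

Inductive deq (R : pzRingType) :
    forall X Y : complex R, dhom X Y -> dhom X Y -> Prop :=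
  | deq_refl X Y (u : dhom X Y) : deq u u
  | deq_sym X Y (u v : dhom X Y) : deq u v -> deq v u
  | deq_trans X Y (u v w : dhom X Y) : deq u v -> deq v w -> deq u w
  | deq_comp X Y Z (g g' : dhom Y Z) (f f' : dhom X Y) :
      deq g g' -> deq f f' -> deq (Dcomp g f) (Dcomp g' f')
  | deq_assoc X Y Z T (h : dhom Z T) (g : dhom Y Z) (f : dhom X Y) :
      deq (Dcomp h (Dcomp g f)) (Dcomp (Dcomp h g) f)
  | deq_idl X Y (f : dhom X Y) : deq (Dcomp (did Y) f) f
  | deq_idr X Y (f : dhom X Y) : deq (Dcomp f (did X)) f
  | deq_map X Y (f g : chain_map X Y) :
      (forall i (x : X i), f i x = g i x) -> deq (Dmap f) (Dmap g)
  | deq_mapM X Y Z (g : chain_map Y Z) (f : chain_map X Y) :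
      deq (Dmap (chain_comp g f)) (Dcomp (Dmap g) (Dmap f))
  | deq_invl X Y (s : chain_map X Y) (qs : quasi_iso s) :
      deq (Dcomp (Dinv qs) (Dmap s)) (did X)
  | deq_invr X Y (s : chain_map X Y) (qs : quasi_iso s) :
      deq (Dcomp (Dmap s) (Dinv qs)) (did Y).

Definition dzero (R : pzRingType) (X Y : complex R) : dhom X Y :=
  Dmap (chain_zero X Y).

Definition dis_iso (R : pzRingType) (X Y : complex R) (u : dhom X Y) : Prop :=
  exists v : dhom Y X, deq (Dcomp v u) (did X) /\ deq (Dcomp u v) (did Y).

Definition disomorphic (R : pzRingType) (X Y : complex R) : Prop :=
  exists u : dhom X Y, dis_iso u.

Fixpoint dshift (R : pzRingType) (X Y : complex R) (u : dhom X Y) :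
    dhom (shift X) (shift Y) :=
  match u with
  | Dmap _ _ f => Dmap (shift_map f)
  | Dinv _ _ _ qs => Dinv (shift_quasi_iso qs)
  | Dcomp _ _ _ g f => Dcomp (dshift g) (dshift f)
  end.

(* [X -u-> Y -v-> Z -w-> X[1]] is isomorphic in [D(Mod-R)] to the image
   [A -f-> B -> C(f) -> A[1]] of the standard triangle of some chain map [f]. *)
Definition distinguished (R : pzRingType) (X Y Z : complex R)
    (u : dhom X Y) (v : dhom Y Z) (w : dhom Z (shift X)) : Prop :=
  exists (A B : complex R) (f : chain_map A B)
         (a : dhom X A) (b : dhom Y B) (c : dhom Z (cone f)),
    [/\ dis_iso a, dis_iso b & dis_iso c] /\
    [/\ deq (Dcomp b u) (Dcomp (Dmap f) a),
        deq (Dcomp c v) (Dcomp (Dmap (cone_incl f)) b)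
      & deq (Dcomp (dshift a) w) (Dcomp (Dmap (cone_proj f)) c)].

(** * t-structures

    [U] is a full triangulated subcategory of [D(Mod-R)], and [L], [G] are the
    two halves of a t-structure on [U].  Since [shift] is an autoequivalence
    and [G] is closed under isomorphism, [Y] lies in [G[-1]] if and only if
    [shift Y] lies in [G]. *)

Record t_structure_on (R : pzRingType) (U L G : complex R -> Prop) : Prop :=
  TStructureOn {
    tL_sub : forall X, L X -> U X;
    tG_sub : forall X, G X -> U X;
    tL_iso : forall X Y, disomorphic X Y -> L X -> L Y;
    tG_iso : forall X Y, disomorphic X Y -> G X -> G Y;
    tL_shift : forall X, L X -> L (shift X);
    tG_shift : forall Y, G (shift Y) -> G Y;
    t_orth : forall X Y, L X -> U Y -> G (shift Y) ->
      forall u : dhom X Y, deq u (dzero X Y);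
    t_triangle : forall X, U X ->
      exists (A B : complex R) (u : dhom A X) (v : dhom X B)
             (w : dhom B (shift A)),
        [/\ L A, U B, G (shift B) & distinguished u v w] }.

Definition t_restricts (R : pzRingType) (L G U : complex R -> Prop) : Prop :=
  t_structure_on U (fun X => L X /\ U X) (fun X => G X /\ U X).

Definition std_le0 (R : pzRingType) (X : complex R) : Prop :=
  forall i : int, 0 < i -> cohomology_zero X i.

Definition std_ge0 (R : pzRingType) (X : complex R) : Prop :=
  forall i : int, i < 0 -> cohomology_zero X i.

(** * The subcategories [K^-(proj-R)] and [K^{-,b}(proj-R)] of [D(Mod-R)] *)

Definition bounded_above (R : pzRingType) (X : complex R) : Prop :=
  exists N : int, forall i : int, N < i -> forall x : X i, x = 0.

Definition bounded_cohomology (R : pzRingType) (X : complex R) : Prop :=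
  exists s : seq int, forall i : int, i \notin s -> cohomology_zero X i.

Definition Kminus_proj (R : pzRingType) (X : complex R) : Prop :=
  exists P : complex R,
    [/\ bounded_above P, forall i, fgproj (P i) & disomorphic X P].

Definition Kminusb_proj (R : pzRingType) (X : complex R) : Prop :=
  exists P : complex R,
    [/\ bounded_above P, forall i, fgproj (P i), bounded_cohomology P
      & disomorphic X P].

(* Main.v *)
From HB Require Import structures.
Require Import Defs.
From mathcomp Require Import all_boot all_order all_algebra.
From mathcomp Require Import zify.
From Stdlib Require Import IndefiniteDescription.

Set Implicit Arguments.
Unset Strict Implicit.
Unset Printing Implicit Defensive.

Import Order.TTheory GRing.Theory Num.Theory.
Local Open Scope ring_scope.

(* Idea.  The cohomology of a morphism of the localization is well defined, and
   on the subcomplex [tau X] of non-positive cocycles the inclusion in [X] is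
   natural for all such morphisms; this gives the orthogonality of the standard
   t-structure, so that only truncation triangles are at stake.

   If [R] is right coherent and [P] is a bounded above complex of finitely
   generated projectives, one builds degree by degree a complex [A] of free
   modules in non-positive degrees with a map to [P]: the term [A^j] covers the
   kernel of [A^(j+1) (+) P^j -> A^(j+2) (+) P^(j+1)], finitely generated by
   coherence.  The cone of [A -> P] is then the upper truncation.  If [P] has
   bounded cohomology, the long exact sequence bounds that of both truncations.

   Conversely, let [f : P -> Q] and truncate the complex [P -> Q] in degrees 0
   and 1.  The lower truncation [A] has [H^0(A)] mapping onto [ker f].  It is
   also isomorphic to a bounded above complex of finitely generated projectives
   exact in positive degrees; such a complex splits there, so its 0-cocycles
   form a summand, and [H^0(A)] is finitely generated. *)

(** Destructing this equation replaces an arbitrary degree by a successor, the form in which a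
    coboundary is just an element of an image. *)
Lemma succz_surj (i : int) : exists j, succz j = i.
Proof. by exists (i - 1); rewrite succzE subrK. Qed.

(** * Elementary closure properties of cocycles and coboundaries *)

Section Coboundary.
Variable R : pzRingType.
Implicit Types X Y : complex R.

(** Inversion leaves an equation between degrees; injectivity of [succz] and uniqueness of equality
    proofs on [int] remove the transport. *)
Lemma coboundaryS X j (x : X (succz j)) :
  coboundary x <-> exists y, x = diff X j y.
Proof.
split=> [/coboundary_inv [k [e [y ->]]]|[y ->]]; last exact: Coboundary.
have ek := succz_inj e; case: _ / ek y e => y e.
by exists y; rewrite (eq_axiomK e).
Qed.

Lemma coboundaryP X i (a : R^c) (x y : X i) :
  coboundary x -> coboundary y -> coboundary (a *: x + y).
Proof.
have [j ej] := succz_surj i; case: _ / ej x y => x y.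
move=> /coboundaryS [x' ->] /coboundaryS [y' ->].
by apply/coboundaryS; exists (a *: x' + y'); rewrite linearP.
Qed.

Lemma coboundary0 X i : coboundary (0 : X i).
Proof.
have [j ej] := succz_surj i; case: _ / ej.
by apply/coboundaryS; exists 0; rewrite linear0.
Qed.

Lemma coboundaryD X i (x y : X i) :
  coboundary x -> coboundary y -> coboundary (x + y).
Proof. by move=> bx; rewrite -[x]scale1r; apply: coboundaryP. Qed.

Lemma coboundaryN X i (x : X i) : coboundary x -> coboundary (- x).
Proof.
move=> bx; rewrite -scaleN1r -[_ *: _]addr0.
exact: coboundaryP bx (coboundary0 _ _).
Qed.

Lemma coboundaryB X i (x y : X i) :
  coboundary x -> coboundary y -> coboundary (x - y).
Proof. by move=> bx /coboundaryN; apply: coboundaryD. Qed.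

Lemma coboundary_eqmod X i (x y : X i) :
  coboundary (x - y) -> coboundary x <-> coboundary y.
Proof.
move=> bxy; split=> [bx|by_]; last by rewrite -(subrK y x); apply: coboundaryD.
by rewrite -(subKr x y); apply: coboundaryB.
Qed.

Lemma coboundary_cocycle X i (x : X i) : coboundary x -> cocycle x.
Proof. by case=> j y; apply: diffK. Qed.

Lemma coboundary_map X Y (f : chain_map X Y) i (x : X i) :
  coboundary x -> coboundary (f i x).
Proof. by case=> j y; rewrite chain_funC; apply: Coboundary. Qed.

Lemma cocycleP X i (a : R^c) (x y : X i) :
  cocycle x -> cocycle y -> cocycle (a *: x + y).
Proof. by rewrite /cocycle linearP => -> ->; rewrite scaler0 addr0. Qed.

Lemma cocycle_map X Y (f : chain_map X Y) i (x : X i) :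
  cocycle x -> cocycle (f i x).
Proof. by rewrite /cocycle -chain_funC => ->; rewrite linear0. Qed.

End Coboundary.

(** * Cohomology of morphisms of the derived category *)

Section CohomologyRelation.
Variable R : pzRingType.
Implicit Types X Y Z : complex R.

(* The map induced by [u] on cohomology, as a relation between representing
   cocycles, so that no quotient module is needed. *)
Fixpoint hrel X Y (u : dhom X Y) (i : int) : X i -> Y i -> Prop :=
  match u in dhom X Y return X i -> Y i -> Prop with
  | Dmap _ _ f => fun x y => [/\ cocycle x, cocycle y & coboundary (y - f i x)]
  | Dinv _ _ s _ => fun y x =>
      [/\ cocycle x, cocycle y & coboundary (y - s i x)]
  | Dcomp _ _ _ g f => fun x z => exists y, hrel f x y /\ hrel g y z
  end.

Lemma hrel_cocycle X Y (u : dhom X Y) i (x : X i) (y : Y i) :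
  hrel u x y -> cocycle x /\ cocycle y.
Proof.
elim: u x y => {X Y} [X Y f|X Y s qs|X Y Z g IHg f IHf] x y /=.
- by case.
- by case.
- by case=> z [/IHf[cx _] /IHg[_ cz]].
Qed.

Lemma hrel_total X Y (u : dhom X Y) i (x : X i) :
  cocycle x -> exists y, hrel u x y.
Proof.
elim: u x => {X Y} [X Y f|X Y s qs|X Y Z g IHg f IHf] x cx /=.
- exists (f i x); rewrite subrr.
  by split=> //; [apply: cocycle_map|apply: coboundary0].
- by have [_ /(_ _ cx)[y [cy bxy]]] := qs i; exists y.
- have [y fxy] := IHf x cx; have [_ cy] := hrel_cocycle fxy.
  by have [z gyz] := IHg y cy; exists z, y.
Qed.

Lemma hrelP X Y (u : dhom X Y) i (a : R^c) (x x' : X i) (y y' : Y i) :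
  hrel u x y -> hrel u x' y' -> hrel u (a *: x + x') (a *: y + y').
Proof.
elim: u x x' y y' => {X Y} [X Y f|X Y s qs|X Y Z g IHg f IHf] x x' y y' /=.
- move=> [cx cy b] [cx' cy' b']; split; [exact: cocycleP..|].
  by rewrite linearP opprD addrACA -scalerBr; apply: coboundaryP.
- move=> [cx cy b] [cx' cy' b']; split; [exact: cocycleP..|].
  by rewrite linearP opprD addrACA -scalerBr; apply: coboundaryP.
- move=> [z [fz gz]] [z' [fz' gz']]; exists (a *: z + z').
  by split; [apply: IHf|apply: IHg].
Qed.

(** Together with additivity this makes [hrel u] single-valued on cohomology classes. At a formal
    inverse it is the injectivity of the quasi-isomorphism on cohomology. *)
Lemma hrel_coboundary X Y (u : dhom X Y) i (x : X i) (y : Y i) :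
  hrel u x y -> coboundary x -> coboundary y.
Proof.
elim: u x y => {X Y} [X Y f|X Y s qs|X Y Z g IHg f IHf] x y /=.
- by move=> [_ _ b] bx; apply/(coboundary_eqmod b)/coboundary_map.
- move=> [cy cx b] bx; have [inj _] := qs i.
  by apply: inj => //; apply/(coboundary_eqmod b).
- by move=> [z [fz gz]] bx; apply: IHg gz _; apply: IHf fz bx.
Qed.

Lemma coboundary_hrel X Y (u : dhom X Y) i (x : X i) (y : Y i) :
  coboundary x -> coboundary y -> hrel u x y.
Proof.
elim: u x y => {X Y} [X Y f|X Y s qs|X Y Z g IHg f IHf] x y bx by_ /=.
- split; [exact: coboundary_cocycle..|].
  by apply: coboundaryB => //; apply: coboundary_map.
- split; [exact: coboundary_cocycle..|].
  by apply: coboundaryB => //; apply: coboundary_map.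
- exists 0; have b0 := @coboundary0 R Y i.
  by split; [apply: IHf|apply: IHg].
Qed.

Lemma hrel0 X Y (u : dhom X Y) i : hrel u (0 : X i) (0 : Y i).
Proof. by apply: coboundary_hrel; apply: coboundary0. Qed.

Lemma hrelD X Y (u : dhom X Y) i (x x' : X i) (y y' : Y i) :
  hrel u x y -> hrel u x' y' -> hrel u (x + x') (y + y').
Proof. by move=> h h'; have := hrelP 1 h h'; rewrite !scale1r. Qed.

Lemma hrelB X Y (u : dhom X Y) i (x x' : X i) (y y' : Y i) :
  hrel u x y -> hrel u x' y' -> hrel u (x - x') (y - y').
Proof.
by move=> h h'; have := hrelP (-1) h' h; rewrite !scaleN1r ![- _ + _]addrC.
Qed.

Lemma hrel_sum X Y (u : dhom X Y) i n (c : 'I_n -> R^c) (g : 'I_n -> X i)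
    (h : 'I_n -> Y i) :
  (forall k, hrel u (g k) (h k)) ->
  hrel u (\sum_(k < n) c k *: g k) (\sum_(k < n) c k *: h k).
Proof.
move=> gh; apply: (big_ind2 (fun x y => hrel u x y)) => [|x y x' y'|k _].
- exact: hrel0.
- exact: hrelD.
- by have := hrelP (c k) (gh k) (hrel0 u i); rewrite !addr0.
Qed.

Lemma hrel_eqmodl X Y (u : dhom X Y) i (x x' : X i) (y : Y i) :
  hrel u x y -> coboundary (x' - x) -> hrel u x' y.
Proof.
move=> h b; rewrite -(subrK x x') -[y]add0r; apply: hrelD => //.
exact/coboundary_hrel/coboundary0.
Qed.

Lemma hrel_eqmodr X Y (u : dhom X Y) i (x : X i) (y y' : Y i) :
  hrel u x y -> coboundary (y' - y) -> hrel u x y'.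
Proof.
move=> h b; rewrite -(subrK y y') -[x]add0r; apply: hrelD => //.
exact/coboundary_hrel/b/coboundary0.
Qed.

Lemma hrel_did X i (x y : X i) :
  hrel (did X) x y <-> cocycle x /\ coboundary (y - x).
Proof.
split=> [[]//|[cx b]]; split=> //.
rewrite -(subrK x y) -[_ - x]scale1r.
by apply: cocycleP => //; apply: coboundary_cocycle.
Qed.

(** Cohomology is functorial and inverts quasi-isomorphisms, so it respects every generator of the
    congruence. *)
Lemma deq_hrel X Y (u v : dhom X Y) :
  deq u v -> forall i (x : X i) (y : Y i), hrel u x y <-> hrel v x y.
Proof.
elim=> {X Y u v}.
- by [].
- by move=> X Y u v _ IH i x y; split=> /IH.
- by move=> X Y u v w _ IH _ IH' i x y; split=> [/IH/IH'|/IH'/IH].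
- move=> X Y Z g g' f f' _ IHg _ IHf i x y /=.
  by split=> -[z [/IHf ? /IHg ?]]; exists z.
- move=> X Y Z T h g f i x y /=; split.
    by move=> [z [[t [? ?]] ?]]; exists t; split=> //; exists z.
  by move=> [z [? [t [? ?]]]]; exists t; split=> //; exists z.
- move=> X Y f i x y; split=> [[z [h /hrel_did [_ b]]]|h].
    exact: hrel_eqmodr h b.
  have [_ cy] := hrel_cocycle h; exists y; split=> //.
  by apply/hrel_did; rewrite subrr; split=> //; apply: coboundary0.
- move=> X Y f i x y; split=> [[z [/hrel_did [_ b] h]]|h].
    by apply: hrel_eqmodl h _; rewrite -opprB; apply: coboundaryN.
  have [cx _] := hrel_cocycle h; exists x; split=> //.
  by apply/hrel_did; rewrite subrr; split=> //; apply: coboundary0.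
- by move=> X Y f g fg i x y /=; rewrite fg.
- move=> X Y Z g f i x z; split=> [[cx cz b]|].
    exists (f i x); have cf := cocycle_map f cx.
    by split=> //; split=> //; rewrite subrr; apply: coboundary0.
  move=> [y [[cx cy b] [_ cz b']]]; split=> //=.
  rewrite -(subrK (g i y) z) -addrA -linearB.
  by apply: coboundaryD => //; apply: coboundary_map.
- move=> X Y s qs i x y; have [inj _] := qs i; split.
    move=> [z [[cx cz b] [cy _ b']]]; apply/hrel_did; split=> //.
    (* Both [s x] and [s y] are cohomologous to [z], and [s] is injective on cohomology. *)
    apply: inj; first by rewrite -scaleN1r addrC; apply: cocycleP.
    have := coboundaryB b b'.
    by rewrite opprB [_ + (_ - z)]addrC addrA subrK linearB.
  move=> [cx cy b]; exists (s i y); have cs := cocycle_map s cy.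
  split; split=> //; last by rewrite subrr; apply: coboundary0.
  by rewrite -linearB; apply: coboundary_map.
- move=> X Y s qs i x y; have [_ surj] := qs i; split.
    move=> [z [[cz cx b] [_ cy b']]]; split=> //=.
    by rewrite -(subrK (s i z) y) -addrA; apply: coboundaryD => //;
       rewrite -opprB; apply: coboundaryN.
  move=> [cx cy b]; have [z [cz b']] := surj _ cx; exists z; split=> //.
  split=> //=; rewrite -(subrK x y) -addrA; exact: coboundaryD.
Qed.

(** Any value [x'] of [v] at [y] is cohomologous to [x], because the composite acts as the identity;
    hence [x] is a value too. *)
Lemma dis_iso_hrel X Y (u : dhom X Y) (v : dhom Y X) i (x : X i) (y : Y i) :
  deq (Dcomp v u) (did X) -> hrel u x y -> hrel v y x.
Proof.
move=> vu h; have [_ cy] := hrel_cocycle h; have [x' h'] := hrel_total v cy.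
have /(deq_hrel vu)/hrel_did[_ b] : hrel (Dcomp v u) x x' by exists y.
by apply: hrel_eqmodr h' _; rewrite -opprB; apply: coboundaryN.
Qed.

Lemma iso_cohomology_zero X Y i :
  disomorphic X Y -> cohomology_zero X i -> cohomology_zero Y i.
Proof.
move=> [u [v [vu uv]]] zX y cy; have [x h] := hrel_total v cy.
have [_ cx] := hrel_cocycle h.
exact: hrel_coboundary (dis_iso_hrel uv h) (zX x cx).
Qed.

(** Finite generation of the module [H^i(X)], phrased with representing cocycles instead of a
    quotient. *)
Definition fg_cohomology X i : Prop :=
  exists (n : nat) (g : 'I_n -> X i), (forall k, cocycle (g k)) /\
    forall x, cocycle x ->
      exists c : 'I_n -> R^c, coboundary (x - \sum_(k < n) c k *: g k).

Lemma iso_fg_cohomology X Y i :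
  disomorphic X Y -> fg_cohomology X i -> fg_cohomology Y i.
Proof.
move=> [u [v [vu uv]]] [n [g [cg gen]]].
have /fin_all_exists [h gh] k := hrel_total u (cg k).
exists n, h; split=> [k|y cy]; first by have [] := hrel_cocycle (gh k).
have [x yx] := hrel_total v cy; have [_ cx] := hrel_cocycle yx.
have [c b] := gen x cx; exists c.
exact: hrel_coboundary (hrelB (dis_iso_hrel uv yx) (hrel_sum c gh)) b.
Qed.

End CohomologyRelation.

(** * Isomorphisms and zero morphisms in the localization *)

Section Isomorphism.
Variable R : pzRingType.
Implicit Types X Y Z : complex R.

Lemma deq_cancelr X Y Z (a : dhom X Y) (f g : dhom Y Z) :
  dis_iso a -> deq (Dcomp f a) (Dcomp g a) -> deq f g.
Proof.
move=> [b [_ ab]] fg.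
have H (h : dhom Y Z) : deq (Dcomp (Dcomp h a) b) h.
  apply: deq_trans (deq_idr h); apply: deq_trans (deq_comp (deq_refl h) ab).
  exact/deq_sym/deq_assoc.
apply: deq_trans (H g); apply: deq_trans (deq_sym (H f)) _.
exact: deq_comp fg (deq_refl b).
Qed.

Lemma deq_cancell X Y Z (a : dhom Y Z) (f g : dhom X Y) :
  dis_iso a -> deq (Dcomp a f) (Dcomp a g) -> deq f g.
Proof.
move=> [b [ba _]] fg.
have H (h : dhom X Y) : deq (Dcomp b (Dcomp a h)) h.
  apply: deq_trans (deq_idl h); apply: deq_trans (deq_comp ba (deq_refl h)).
  exact: deq_assoc.
apply: deq_trans (H g); apply: deq_trans (deq_sym (H f)) _.
exact: deq_comp (deq_refl b) fg.
Qed.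

Lemma dis_iso_id X : dis_iso (did X).
Proof. by exists (did X); split; apply: deq_idl. Qed.

Lemma dis_iso_qis X Y (s : chain_map X Y) : quasi_iso s -> dis_iso (Dmap s).
Proof.
by move=> qs; exists (Dinv qs); split; [apply: deq_invl|apply: deq_invr].
Qed.

Lemma dis_iso_comp X Y Z (g : dhom Y Z) (f : dhom X Y) :
  dis_iso g -> dis_iso f -> dis_iso (Dcomp g f).
Proof.
move=> [g' [gl gr]] [f' [fl fr]]; exists (Dcomp f' g').
split.
  apply: deq_trans fl; apply: deq_trans (deq_sym (deq_assoc _ _ _)) _.
  apply: deq_comp (deq_refl _) _; apply: deq_trans (deq_assoc _ _ _) _.
  by apply: deq_trans (deq_comp gl (deq_refl _)) (deq_idl _).
apply: deq_trans gr; apply: deq_trans (deq_sym (deq_assoc _ _ _)) _.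
apply: deq_comp (deq_refl _) _; apply: deq_trans (deq_assoc _ _ _) _.
by apply: deq_trans (deq_comp fr (deq_refl _)) (deq_idl _).
Qed.

Lemma disomorphic_refl X : disomorphic X X.
Proof. by exists (did X); apply: dis_iso_id. Qed.

Lemma disomorphic_sym X Y : disomorphic X Y -> disomorphic Y X.
Proof. by move=> [u [v [vu uv]]]; exists v, u. Qed.

Lemma disomorphic_trans X Y Z :
  disomorphic X Y -> disomorphic Y Z -> disomorphic X Z.
Proof.
by move=> [u iu] [v iv]; exists (Dcomp v u); apply: dis_iso_comp.
Qed.

(** Induction on the formal composite. At the formal inverse of [s], precomposing with [s] turns
    both sides into zero chain maps. *)
Lemma deq_zeror X Y Z (u : dhom X Y) :
  deq (Dcomp (dzero Y Z) u) (dzero X Z).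
Proof.
elim: u Z => {X Y} [X Y f|X Y s qs|X Y T g IHg f IHf] Z.
- by apply: deq_trans (deq_sym (deq_mapM _ _)) _; apply: deq_map.
- apply: (deq_cancelr (dis_iso_qis qs)).
  apply: deq_trans (deq_sym (deq_assoc _ _ _)) _.
  apply: deq_trans (deq_comp (deq_refl _) (deq_invl qs)) _.
  apply: deq_trans (deq_idr _) _.
  by apply: deq_trans (deq_mapM _ _); apply: deq_map.
- apply: deq_trans (deq_assoc _ _ _) _.
  by apply: deq_trans (deq_comp (IHg _) (deq_refl _)) (IHf _).
Qed.

(** The zero endomorphism of an acyclic complex is a quasi-isomorphism, hence can be cancelled, and
    [f] agrees with zero after it. *)
Lemma acyclic_dzero X Y (f : chain_map X Y) :
  (forall i, cohomology_zero X i) -> deq (Dmap f) (dzero X Y).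
Proof.
move=> zX; have q0 : quasi_iso (chain_zero X X).
  move=> i; split=> [x cx _|y cy]; first exact: zX.
  by exists 0; split; [apply: linear0|rewrite /= subr0; apply: zX].
apply: (deq_cancelr (dis_iso_qis q0)).
apply: deq_trans (deq_sym (deq_mapM _ _)) _; apply: deq_trans (deq_mapM _ _).
by apply: deq_map => i x /=; rewrite linear0.
Qed.

End Isomorphism.

(** * Functors induced on the derived category *)

Section Functor.
Variable R : pzRingType.
Variable F : complex R -> complex R.
Variable Fmap : forall X Y, chain_map X Y -> chain_map (F X) (F Y).
Hypothesis Fmap_ext : forall X Y (f g : chain_map X Y),
  (forall i x, f i x = g i x) -> forall i x, Fmap f i x = Fmap g i x.
Hypothesis Fmap_id : forall X i x, Fmap (chain_id X) i x = x.
Hypothesis Fmap_comp : forall X Y Z (g : chain_map Y Z) (f : chain_map X Y) i x,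
  Fmap (chain_comp g f) i x = Fmap g i (Fmap f i x).
Hypothesis Fmap_qis : forall X Y (f : chain_map X Y),
  quasi_iso f -> quasi_iso (Fmap f).

(** The extension given by the universal property of the localization: [Fmap] preserves
    quasi-isomorphisms, so formal inverses have an image. *)
Fixpoint dfunctor X Y (u : dhom X Y) : dhom (F X) (F Y) :=
  match u with
  | Dmap _ _ f => Dmap (Fmap f)
  | Dinv _ _ _ qs => Dinv (Fmap_qis qs)
  | Dcomp _ _ _ g f => Dcomp (dfunctor g) (dfunctor f)
  end.

Lemma dfunctor_id X : deq (Dmap (Fmap (chain_id X))) (did (F X)).
Proof. by apply: deq_map => i x; rewrite Fmap_id. Qed.

Lemma dfunctor_deq X Y (u v : dhom X Y) :
  deq u v -> deq (dfunctor u) (dfunctor v).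
Proof.
elim=> {X Y u v} /=.
- by move=> *; apply: deq_refl.
- by move=> *; apply: deq_sym.
- by move=> X Y u v w _ IH _; apply: deq_trans.
- by move=> *; apply: deq_comp.
- by move=> *; apply: deq_assoc.
- move=> X Y f; apply: deq_trans (deq_idl _).
  exact: deq_comp (dfunctor_id _) (deq_refl _).
- move=> X Y f; apply: deq_trans (deq_idr _).
  exact: deq_comp (deq_refl _) (dfunctor_id _).
- by move=> X Y f g fg; apply: deq_map; apply: Fmap_ext.
- move=> X Y Z g f; apply: deq_trans (deq_mapM _ _).
  by apply: deq_map => i x; apply: Fmap_comp.
- by move=> X Y s qs; apply: deq_trans (deq_invl _) (deq_sym (dfunctor_id _)).
- by move=> X Y s qs; apply: deq_trans (deq_invr _) (deq_sym (dfunctor_id _)).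
Qed.

Lemma disomorphic_functor X Y : disomorphic X Y -> disomorphic (F X) (F Y).
Proof.
move=> [u [v [/dfunctor_deq vu /dfunctor_deq uv]]].
exists (dfunctor u), (dfunctor v).
by split; [apply: deq_trans vu _|apply: deq_trans uv _]; apply: dfunctor_id.
Qed.

Variable eta : forall X, chain_map (F X) X.
Hypothesis eta_nat : forall X Y (f : chain_map X Y) i x,
  f i (eta X i x) = eta Y i (Fmap f i x).

(** Naturality squares compose; the square of a formal inverse of [s] follows from that of [s] after
    cancelling [s] on the left. *)
Lemma dfunctor_nat X Y (u : dhom X Y) :
  deq (Dcomp u (Dmap (eta X))) (Dcomp (Dmap (eta Y)) (dfunctor u)).
Proof.
elim: u => {X Y} [X Y f|X Y s qs|X Y Z g IHg f IHf] /=.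
- apply: deq_trans (deq_sym (deq_mapM _ _)) _; apply: deq_trans (deq_mapM _ _).
  by apply: deq_map => i x; apply: eta_nat.
- have H : deq (Dcomp (Dmap s) (Dmap (eta X)))
               (Dcomp (Dmap (eta Y)) (Dmap (Fmap s))).
    apply: deq_trans (deq_sym (deq_mapM _ _)) _.
    apply: deq_trans (deq_mapM _ _).
    by apply: deq_map => i x; apply: eta_nat.
  apply: (deq_cancell (dis_iso_qis qs)).
  apply: deq_trans (deq_assoc _ _ _) _.
  apply: deq_trans (deq_comp (deq_invr qs) (deq_refl _)) _.
  apply: deq_trans (deq_idl _) _; apply: deq_sym.
  apply: deq_trans (deq_assoc _ _ _) _.
  apply: deq_trans (deq_comp H (deq_refl _)) _.
  apply: deq_trans (deq_sym (deq_assoc _ _ _)) _.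
  apply: deq_trans (deq_comp (deq_refl _) (deq_invr _)) _.
  exact: deq_idr.
- apply: deq_trans (deq_sym (deq_assoc _ _ _)) _.
  apply: deq_trans (deq_comp (deq_refl _) IHf) _.
  apply: deq_trans (deq_assoc _ _ _) _.
  apply: deq_trans (deq_comp IHg (deq_refl _)) _.
  exact/deq_sym/deq_assoc.
Qed.

End Functor.

(** * Compatibility of isomorphisms and vanishing of cohomology with the shift *)

Lemma disomorphic_shift (R : pzRingType) (X Y : complex R) :
  disomorphic X Y -> disomorphic (shift X) (shift Y).
Proof.
apply: (disomorphic_functor (Fmap := @shift_map R)) => //=.
exact: shift_quasi_iso.
Qed.

Lemma cohomology_zero_shift (R : pzRingType) (X : complex R) i :
  cohomology_zero (shift X) i <-> cohomology_zero X (succz i).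
Proof.
by split=> zX x /shift_cocycle cx; apply/shift_coboundary/zX.
Qed.

Lemma std_ge0_shift (R : pzRingType) (X : complex R) :
  std_ge0 (shift X) <-> forall i, i <= 0 -> cohomology_zero X i.
Proof.
split=> zX i i0; last by apply/cohomology_zero_shift/zX; rewrite succzE; lia.
have [j ej] := succz_surj i; case: _ / ej i0 => j0.
by apply/cohomology_zero_shift/zX; move: j0; rewrite succzE; lia.
Qed.

(** * The inverse shift, needed to descend properties from [shift X] to [X] *)

Section Unshift.
Variable R : pzRingType.
Implicit Types X Y : complex R.

(** Defined by cases, like [succz], so that the two composites with [succz] reduce to the identity
    on constructors. *)
Definition predz (i : int) : int :=
  match i with
  | Posz 0 => Negz 0
  | Posz n.+1 => Posz n
  | Negz n => Negz n.+1
  end.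

Definition unshift_diff X (i : int) :
    {linear X (predz i) -> X (predz (succz i))} :=
  match i return {linear X (predz i) -> X (predz (succz i))} with
  | Posz 0 => \- diff X (Negz 0)
  | Posz n.+1 => \- diff X (Posz n)
  | Negz 0 => \- diff X (Negz 1)
  | Negz n.+1 => \- diff X (Negz n.+2)
  end.

Lemma unshift_subproof X i (x : X (predz i)) :
  unshift_diff X (succz i) (unshift_diff X i x) = 0.
Proof.
by move: x; case: i => [[|n]|[|[|n]]] x;
  rewrite /= linearN opprK; exact: (diffK (c := X) x).
Qed.

Definition unshift X : complex R :=
  @Complex R (fun i => X (predz i)) (unshift_diff X) (@unshift_subproof X).

Lemma unshift_map_subproof X Y (f : chain_map X Y) i (x : unshift X i) :
  f (predz (succz i)) (diff (unshift X) i x)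
  = diff (unshift Y) i (f (predz i) x).
Proof.
by move: x; case: i => [[|n]|[|n]] x;
  rewrite /= linearN; congr (- _); exact: (chain_funC f x).
Qed.

Definition unshift_map X Y (f : chain_map X Y) :
    chain_map (unshift X) (unshift Y) :=
  @ChainMap R (unshift X) (unshift Y) (fun i => f (predz i))
    (unshift_map_subproof f).

Lemma unshift_cocycle X i (x : unshift X i) :
  cocycle x <-> @cocycle R X (predz i) x.
Proof.
rewrite /cocycle; move: x; case: i => [[|n]|[|n]] x /=;
  by split=> [/eqP|->]; rewrite ?oppr0 // oppr_eq0 => /eqP.
Qed.

Lemma unshift_coboundary X i (x : unshift X i) :
  coboundary x <-> @coboundary R X (predz i) x.
Proof.
split=> [|H].
  case=> j y; move: y; case: j => [[|n]|[|n]] /= y; rewrite -linearN;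
    exact: (@Coboundary R X _ (- y)).
have [j ej] := succz_surj i; case: _ / ej x H => x H.
apply/coboundaryS; move: x H; case: j => [[|n]|[|n]] x.
- move/(@coboundaryS R X (Negz 0)) => [y ->].
  by exists (- y); rewrite /= linearN opprK.
- move/(@coboundaryS R X (Posz n)) => [y ->].
  by exists (- y); rewrite /= linearN opprK.
- move/(@coboundaryS R X (Negz 1)) => [y ->].
  by exists (- y); rewrite /= linearN opprK.
- move/(@coboundaryS R X (Negz n.+2)) => [y ->].
  by exists (- y); rewrite /= linearN opprK.
Qed.

Lemma unshift_quasi_iso X Y (f : chain_map X Y) :
  quasi_iso f -> quasi_iso (unshift_map f).
Proof.
move=> qf i; have [inj surj] := qf (predz i); split=> [x|y].
  move=> /unshift_cocycle cx /unshift_coboundary bx.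
  by apply/unshift_coboundary/inj.
move=> /unshift_cocycle /surj [x [cx bx]].
by exists x; split; [apply/unshift_cocycle|apply/unshift_coboundary].
Qed.

Lemma disomorphic_unshift X Y :
  disomorphic X Y -> disomorphic (unshift X) (unshift Y).
Proof.
apply: (disomorphic_functor (Fmap := unshift_map)) => //=.
exact: unshift_quasi_iso.
Qed.

(** The identity in every degree: the two signs cancel, and each branch makes source and target
    convertible. *)
Definition unshiftK_fun X i : {linear unshift (shift X) i -> X i} :=
  match i return {linear X (succz (predz i)) -> X i} with
  | Posz 0 | Posz _.+1 | Negz _ => idfun
  end.

Definition unshiftK_inv X i : {linear X i -> unshift (shift X) i} :=
  match i return {linear X i -> X (succz (predz i))} with
  | Posz 0 | Posz _.+1 | Negz _ => idfun
  end.

Lemma unshiftK_fun_subproof X i (x : unshift (shift X) i) :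
  unshiftK_fun X (succz i) (diff (unshift (shift X)) i x)
  = diff X i (unshiftK_fun X i x).
Proof. by move: x; case: i => [[|n]|[|n]] x /=; rewrite opprK. Qed.

Lemma unshiftK_inv_subproof X i (x : X i) :
  unshiftK_inv X (succz i) (diff X i x)
  = diff (unshift (shift X)) i (unshiftK_inv X i x).
Proof. by move: x; case: i => [[|n]|[|n]] x /=; rewrite opprK. Qed.

Lemma disomorphic_unshift_shift X : disomorphic (unshift (shift X)) X.
Proof.
exists (Dmap (ChainMap (@unshiftK_fun_subproof X))).
exists (Dmap (ChainMap (@unshiftK_inv_subproof X))).
split; apply: deq_trans (deq_sym (deq_mapM _ _)) _; apply: deq_map.
  by move=> [[|n]|n] x.
by move=> [[|n]|n] x.
Qed.

End Unshift.

(** * Truncation and orthogonality *)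

Section Truncation.
Variable R : pzRingType.
Implicit Types X Y : complex R.

(* The subcomplex [... -> X^(-1) -> Z^0(X) -> 0 -> ...]. *)
Definition tau_pred X (i : int) : {pred X i} :=
  fun x => if 0 < i then x == 0 else (i < 0) || (diff X i x == 0).

Lemma tau_submod_closed X i : submod_closed (@tau_pred X i).
Proof.
rewrite /tau_pred; split=> [|a x y]; rewrite !unfold_in; case: ifP => _.
- by [].
- by rewrite linear0 eqxx orbT.
- by move=> /eqP -> /eqP ->; rewrite scaler0 addr0.
- case: ltP => //= _ /eqP dx /eqP dy.
  by rewrite linearP dx dy scaler0 addr0.
Qed.

HB.instance Definition _ X i :=
  GRing.isSubmodClosed.Build R^c (X i) (@tau_pred X i) (@tau_submod_closed X i).

Record tau_obj X i := TauObj { tau_val : X i; _ : tau_val \in @tau_pred X i }.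

HB.instance Definition _ X i := [isSub for @tau_val X i].
HB.instance Definition _ X i := [Choice of tau_obj X i by <:].
HB.instance Definition _ X i := [SubChoice_isSubLmodule of tau_obj X i by <:].

Lemma tau_val_linear X i : linear (@tau_val X i).
Proof. exact: (@linearP _ _ _ _ (\val : {linear tau_obj X i -> X i})). Qed.

HB.instance Definition _ X i :=
  GRing.isLinear.Build R^c (tau_obj X i) (X i) *:%R (@tau_val X i)
    (@tau_val_linear X i).

Lemma tau_valP X i (x : tau_obj X i) : tau_val x \in @tau_pred X i.
Proof. by case: x. Qed.

Lemma tau_val_inj X i : injective (@tau_val X i).
Proof. exact: val_inj. Qed.

Section TauLift.
Variables (X Y : complex R) (i j : int) (f : {linear X i -> Y j}).
Hypothesis tau_f : forall x, x \in @tau_pred X i -> f x \in @tau_pred Y j.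

Definition tau_lift (x : tau_obj X i) : tau_obj Y j :=
  TauObj (tau_f (tau_valP x)).

Lemma tau_lift_linear : linear tau_lift.
Proof. by move=> a x y; apply: tau_val_inj; rewrite /= !linearP. Qed.

HB.instance Definition _ :=
  GRing.isLinear.Build R^c (tau_obj X i) (tau_obj Y j) *:%R tau_lift
    tau_lift_linear.

End TauLift.

Lemma tau_diffP X i (x : X i) :
  x \in @tau_pred X i -> diff X i x \in @tau_pred X (succz i).
Proof.
rewrite /tau_pred !unfold_in diffK eqxx orbT.
case: (ifP (0 < succz i)) => // i1.
case: ifP => [_ /eqP ->|_]; first by rewrite linear0.
by case: ltP => //= i0 _; exfalso; move: i1; rewrite succzE; lia.
Qed.

Lemma tau_mapP X Y (f : chain_map X Y) i (x : X i) :
  x \in @tau_pred X i -> f i x \in @tau_pred Y i.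
Proof.
rewrite /tau_pred !unfold_in.
case: ifP => [_ /eqP ->|_]; first by rewrite linear0.
by case: ltP => //= _ /eqP dx; rewrite -chain_funC dx linear0.
Qed.

Lemma tau_subproof X i (x : tau_obj X i) :
  tau_lift (@tau_diffP X (succz i)) (tau_lift (@tau_diffP X i) x) = 0.
Proof. by apply: tau_val_inj; rewrite /= diffK. Qed.

Definition tau X : complex R :=
  @Complex R (fun i => tau_obj X i) (fun i => tau_lift (@tau_diffP X i))
    (@tau_subproof X).

Lemma tau_map_subproof X Y (f : chain_map X Y) i (x : tau X i) :
  tau_lift (@tau_mapP X Y f (succz i)) (diff (tau X) i x)
  = diff (tau Y) i (tau_lift (@tau_mapP X Y f i) x).
Proof. by apply: tau_val_inj; rewrite /= chain_funC. Qed.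

Definition tau_map X Y (f : chain_map X Y) : chain_map (tau X) (tau Y) :=
  @ChainMap R (tau X) (tau Y) (fun i => tau_lift (@tau_mapP X Y f i))
    (tau_map_subproof f).

Lemma tau_incl_subproof X i (x : tau X i) :
  tau_val (diff (tau X) i x) = diff X i (tau_val x).
Proof. by []. Qed.

Definition tau_incl X : chain_map (tau X) X :=
  @ChainMap R (tau X) X (fun i => @tau_val X i) (@tau_incl_subproof X).

Lemma tau_cocycle X i (x : tau X i) : cocycle x <-> cocycle (tau_val x).
Proof.
split=> [cx|cx]; first by rewrite /cocycle -tau_incl_subproof cx linear0.
by apply: tau_val_inj; rewrite linear0.
Qed.

Lemma tau_eq0 X i (x : tau X i) : 0 < i -> x = 0.
Proof.
move=> i0; apply: tau_val_inj; rewrite linear0; apply/eqP.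
by have := tau_valP x; rewrite unfold_in /tau_pred i0.
Qed.

(** A primitive of [x] has negative degree, where [tau X] is all of [X]. *)
Lemma tau_coboundary X i (x : tau X i) :
  i <= 0 -> coboundary x <-> coboundary (tau_val x).
Proof.
move=> i0; split=> [|b]; first exact: (coboundary_map (tau_incl X)).
have [j ej] := succz_surj i; case: _ / ej i0 x b => i0 x /coboundaryS [y xy].
rewrite succzE in i0.
have ty : y \in @tau_pred X j.
  have j0 : j < 0 by lia.
  by rewrite unfold_in /tau_pred j0 ltNge (ltW j0).
by apply/coboundaryS; exists (TauObj ty); apply: tau_val_inj.
Qed.

Lemma tau_lift_cocycle X i (x : X i) :
  i <= 0 -> cocycle x -> exists2 y : tau X i, cocycle y & tau_val y = x.
Proof.
move=> i0 cx; have tx : x \in @tau_pred X i.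
  by rewrite unfold_in /tau_pred cx eqxx orbT ltNge i0.
by exists (TauObj tx) => //; apply/tau_cocycle.
Qed.

Lemma tau_cohomology_zero X i :
  (i <= 0 -> cohomology_zero X i) -> cohomology_zero (tau X) i.
Proof.
move=> zX x /tau_cocycle cx; case: (lerP i 0) => i0.
  by apply/(tau_coboundary _ i0); apply: zX.
by rewrite (tau_eq0 x i0); apply: coboundary0.
Qed.

Lemma tau_incl_qis X : std_le0 X -> quasi_iso (tau_incl X).
Proof.
move=> leX i; case: (lerP i 0) => i0; split.
- by move=> x _ /(tau_coboundary _ i0).
- move=> y /(tau_lift_cocycle i0) [x cx <-]; exists x; split=> //.
  by rewrite subrr; apply: coboundary0.
- by move=> x _ _; rewrite (tau_eq0 x i0); apply: coboundary0.
- move=> y cy; exists 0; split; first exact: linear0.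
  by rewrite (linear0 (tau_incl X i)) subr0; apply: leX.
Qed.

Lemma tau_quasi_iso X Y (f : chain_map X Y) :
  quasi_iso f -> quasi_iso (tau_map f).
Proof.
move=> qf i; have [inj surj] := qf i; case: (lerP i 0) => i0; split.
- move=> x /tau_cocycle cx /(tau_coboundary _ i0) b.
  by apply/(tau_coboundary _ i0)/inj.
- move=> y /tau_cocycle /surj [x [/(tau_lift_cocycle i0) [x' cx' <-] b]].
  by exists x'; split=> //; apply/(tau_coboundary _ i0); rewrite linearB.
- by move=> x _ _; rewrite (tau_eq0 x i0); apply: coboundary0.
- move=> y _; exists 0; split; first exact: linear0.
  by rewrite (linear0 (tau_map f i)) subr0 (tau_eq0 y i0); apply: coboundary0.
Qed.

(** As [tau X -> X] is invertible, it suffices to kill [u] after it. By naturality that composite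
    factors through [tau Y], which is acyclic. *)
Lemma std_orthogonal X Y (u : dhom X Y) :
  std_le0 X -> std_ge0 (shift Y) -> deq u (dzero X Y).
Proof.
move=> leX geY; apply: (deq_cancelr (dis_iso_qis (tau_incl_qis leX))).
have nat := dfunctor_nat (Fmap := tau_map) tau_quasi_iso (eta := tau_incl) _ u.
apply: deq_trans (nat _) _; first by [].
have zY : forall i, cohomology_zero (tau Y) i.
  by move=> i; apply: tau_cohomology_zero; apply: (std_ge0_shift Y).1.
apply: deq_trans (deq_comp (acyclic_dzero _ zY) (deq_refl _)) _.
exact: deq_trans (deq_zeror _ _) (deq_sym (deq_zeror _ _)).
Qed.

End Truncation.

(** * Finitely generated projective modules *)

Section FreeModule.
Variable R : pzRingType.

Section LinearCombination.
Variables (M : rmodType R) (n : nat) (g : 'I_n -> M).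

Definition lincomb (c : 'rV[R^c]_n) : M := \sum_(k < n) c 0 k *: g k.

Lemma lincomb_linear : linear lincomb.
Proof.
move=> a x y; rewrite /lincomb scaler_sumr -big_split /=.
by apply: eq_bigr => k _; rewrite !mxE scalerDl scalerA.
Qed.

HB.instance Definition _ :=
  GRing.isLinear.Build R^c 'rV[R^c]_n M *:%R lincomb lincomb_linear.

End LinearCombination.

Lemma fgproj_free n : fgproj 'rV[R^c]_n.
Proof.
have row_lincomb (x : 'rV[R^c]_n) :
    x = \sum_(k < n) x 0 k *: delta_mx 0 k := row_sum_delta x.
split; first by exists n, (delta_mx 0); split=> // x _; exists (x 0).
move=> A B p f psurj.
have /fin_all_exists [h ph] (k : 'I_n) := psurj (f (delta_mx 0 k)).
exists (lincomb h) => x; rewrite {2}[x]row_lincomb /= /lincomb !linear_sum.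
by apply: eq_bigr => k _; rewrite !linearZ ph.
Qed.

Section PairInjections.
Variables M N : rmodType R.

Definition pair_inl (x : M) : (M * N)%type := (x, 0).
Definition pair_inr (y : N) : (M * N)%type := (0, y).

Lemma pair_inl_linear : linear pair_inl.
Proof. by move=> a x y; congr (_, _); rewrite /= scaler0 addr0. Qed.

Lemma pair_inr_linear : linear pair_inr.
Proof. by move=> a x y; congr (_, _); rewrite /= scaler0 addr0. Qed.

HB.instance Definition _ :=
  GRing.isLinear.Build R^c M (M * N)%type *:%R pair_inl pair_inl_linear.
HB.instance Definition _ :=
  GRing.isLinear.Build R^c N (M * N)%type *:%R pair_inr pair_inr_linear.

Lemma pair_split (p : (M * N)%type) : p = pair_inl p.1 + pair_inr p.2.
Proof. by case: p => x y; congr (_, _); rewrite /= ?addr0 ?add0r. Qed.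

End PairInjections.

Lemma fgproj_pair (M N : rmodType R) :
  fgproj M -> fgproj N -> fgproj (M * N)%type.
Proof.
move=> [[m [g [_ gen_g]]] projM] [[n [h [_ gen_h]]] projN]; split.
  exists (m + n)%N, (fun k => match split k with
    inl i => pair_inl N (g i) | inr i => pair_inr M (h i) end).
  split=> // p _; have [c xE] := gen_g p.1 I; have [e yE] := gen_h p.2 I.
  exists (fun k => match split k with inl i => c i | inr i => e i end).
  rewrite big_split_ord /= [LHS]pair_split xE yE !linear_sum.
  congr (_ + _); apply: eq_bigr => i _; rewrite linearZ.
    by rewrite (unsplitK (inl i)).
  by rewrite (unsplitK (inr i)).
move=> A B p f psurj.
have [h1 ph1] := projM A B p (f \o @pair_inl M N) psurj.
have [h2 ph2] := projN A B p (f \o @pair_inr M N) psurj.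
exists ((h1 \o fst) \+ (h2 \o snd)) => x /=.
by rewrite linearD ph1 ph2 /= -linearD -pair_split.
Qed.

End FreeModule.

(** * Covering of non-positive cohomology over a coherent ring *)

Section Stage.
Variable R : pzRingType.
Hypothesis coherentR : right_coherent R.
Variable P : complex R.
Hypothesis fgprojP : forall i, fgproj (P i).

(* The two lowest terms [cur -> nxt] of a partially built complex over [P],
   with [cur] in degree [i]. *)
Record stage (i : int) := Stage {
  cur : rmodType R;
  nxt : rmodType R;
  stage_diff : {linear cur -> nxt};
  stage_map : {linear cur -> P i};
  fgproj_cur : fgproj cur;
  fgproj_nxt : fgproj nxt }.

Section NextStage.
Variables (j : int) (s : stage (succz j)).

(* The kernel of [gap] consists of the elements that the next term, of degree
   [j], must hit for the map to [P] to be bijective on cohomology. *)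
Definition gap (p : (cur s * P j)%type) : (nxt s * P (succz j))%type :=
  (stage_diff s p.1, stage_map s p.1 - diff P j p.2).

Lemma gap_linear : linear gap.
Proof.
move=> a x y; rewrite /gap; congr (_, _); rewrite /= linearP //=.
by rewrite linearP opprD addrACA scalerBr.
Qed.

HB.instance Definition _ :=
  GRing.isLinear.Build R^c (cur s * P j)%type (nxt s * P (succz j))%type *:%R
    gap gap_linear.

(** Coherence applies to [gap], a map between finitely generated projectives. The number of
    generators and the generators form one pair, so that a single choice extracts both. *)
Lemma gap_cover : exists ng : {n & 'I_n -> (cur s * P j)%type},
  forall x, gap x = 0 <-> exists c, x = lincomb (projT2 ng) c.
Proof.
have [n [g [g0 gen]]] := coherentR gap
  (fgproj_pair (fgproj_cur s) (fgprojP j))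
  (fgproj_pair (fgproj_nxt s) (fgprojP (succz j))).
exists (existT _ n g) => x; split=> /= [/gen [c ->]|[c ->]].
  exists (\row_k c k); rewrite /lincomb.
  by apply: eq_bigr => k _; rewrite mxE.
rewrite /lincomb linear_sum big1 // => k _.
by rewrite linearZ /= g0 scaler0.
Qed.

Definition gap_gens :=
  projT2 (proj1_sig (constructive_indefinite_description _ gap_cover)).

(** A free module on the chosen generators of the kernel of [gap]; the components of a generator
    give its differential and its image in [P]. *)
Definition next_stage : stage j :=
  @Stage j _ (cur s) (fst \o lincomb gap_gens) (snd \o lincomb gap_gens)
    (fgproj_free R _) (fgproj_cur s).

Lemma next_stage_gap (x : cur next_stage) :
  stage_diff s (stage_diff next_stage x) = 0 /\
  stage_map s (stage_diff next_stage x) = diff P j (stage_map next_stage x).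
Proof.
pose H := proj2_sig (constructive_indefinite_description _ gap_cover).
have g0 : gap (lincomb gap_gens x) = 0 by apply/H; exists x.
split; first exact: (congr1 fst g0).
by apply/eqP; rewrite -subr_eq0; apply/eqP; exact: (congr1 snd g0).
Qed.

Lemma next_stage_exact a p :
  stage_diff s a = 0 -> stage_map s a = diff P j p ->
  exists x, stage_diff next_stage x = a /\ stage_map next_stage x = p.
Proof.
move=> da fa.
pose H := proj2_sig (constructive_indefinite_description _ gap_cover).
have [|x xE] := (H (a, p)).1; first by rewrite /gap /= da fa subrr.
by exists x; rewrite /= /gap_gens -xE.
Qed.

End NextStage.

(** The construction starts from zero in degrees 1 and 2, so that the term in degree 0 covers the
    0-cocycles of [P]. *)
Definition stage1 : stage (Posz 1) :=
  @Stage (Posz 1) 'rV[R^c]_0 'rV[R^c]_0 \0 \0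
    (fgproj_free R 0) (fgproj_free R 0).

Definition stage0 : stage (Posz 0) := @next_stage (Posz 0) stage1.

Fixpoint stageN n : stage (Negz n) :=
  match n with
  | 0 => @next_stage (Negz 0) stage0
  | m.+1 => @next_stage (Negz m.+1) (stageN m)
  end.

Definition cover_obj (i : int) : rmodType R :=
  match i with
  | Posz 0 => cur stage0
  | Posz _.+1 => 'rV[R^c]_0
  | Negz n => cur (stageN n)
  end.

Definition cover_diff (i : int) : {linear cover_obj i -> cover_obj (succz i)} :=
  match i return {linear cover_obj i -> cover_obj (succz i)} with
  | Posz 0 => stage_diff stage0
  | Posz _.+1 => \0
  | Negz 0 => stage_diff (stageN 0)
  | Negz n.+1 => stage_diff (stageN n.+1)
  end.

Definition cover_fun (i : int) : {linear cover_obj i -> P i} :=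
  match i return {linear cover_obj i -> P i} with
  | Posz 0 => stage_map stage0
  | Posz _.+1 => \0
  | Negz n => stage_map (stageN n)
  end.

Lemma cover_diffK i (x : cover_obj i) :
  cover_diff (succz i) (cover_diff i x) = 0.
Proof.
move: x; case: i => [[|n]|[|[|n]]] x //.
- by have [] := @next_stage_gap (Negz 0) stage0 x.
- by have [] := @next_stage_gap (Negz 1) (stageN 0) x.
- by have [] := @next_stage_gap (Negz n.+2) (stageN n.+1) x.
Qed.

Definition cover : complex R := Complex cover_diffK.

Lemma cover_funC i (x : cover i) :
  cover_fun (succz i) (diff cover i x) = diff P i (cover_fun i x).
Proof.
move: x; case: i => [[|n]|[|n]] x.
- by have [] := @next_stage_gap (Posz 0) stage1 x.
- by rewrite /= linear0.
- by have [] := @next_stage_gap (Negz 0) stage0 x.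
- by have [] := @next_stage_gap (Negz n.+1) (stageN n) x.
Qed.

Definition cover_map : chain_map cover P := ChainMap cover_funC.

(** This one property encodes injectivity on [H^(i+1)] (for coboundaries in [P]) and surjectivity on
    [H^i] (for [a = 0]). *)
Lemma cover_exact i (a : cover (succz i)) (p : P i) :
  i <= 0 -> cocycle a -> cover_map (succz i) a = diff P i p ->
  exists x : cover i, diff cover i x = a /\ cover_map i x = p.
Proof.
move: a p; case: i => [[|n]|[|n]] a p // _.
- by move=> _; apply: (@next_stage_exact (Posz 0) stage1).
- exact: (@next_stage_exact (Negz 0) stage0).
- move: n a p => [|n] a p; first exact: (@next_stage_exact (Negz 1) (stageN 0)).
  exact: (@next_stage_exact (Negz n.+2) (stageN n.+1)).
Qed.

Lemma cover_eq0 i (x : cover i) : 0 < i -> x = 0.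
Proof. by move: x; case: i => [[|n]|n] // x _; apply/rowP => -[]. Qed.

Lemma fgproj_cover i : fgproj (cover i).
Proof.
by case: i => [[|n]|n];
  [apply: fgproj_cur|apply: fgproj_free|apply: fgproj_cur].
Qed.

Lemma std_le0_cover : std_le0 cover.
Proof. by move=> i i0 x _; rewrite (cover_eq0 x i0); apply: coboundary0. Qed.

Lemma std_ge0_cone_cover : std_ge0 (shift (cone cover_map)).
Proof.
apply/std_ge0_shift => i; have [j <-] := succz_surj i => j0 [a p].
move=> c0; have da : cocycle a.
  by apply/eqP; rewrite -oppr_eq0; apply/eqP; exact: (congr1 fst c0).
have fa : cover_map _ a + diff P _ p = 0 := congr1 snd c0.
have [|x [dx fx]] := @cover_exact (succz j) a (- p) j0 da.
  by rewrite linearN; apply/eqP; rewrite -addr_eq0 fa.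
(* The cone differential sends [(-x, 0)] to [(d x, - f x)], which is [(a, p)]. *)
apply/coboundaryS; exists (- x, 0); rewrite /= /cone_diff /=.
by rewrite !linearN dx fx !opprK linear0 addr0.
Qed.

End Stage.

(** * Restriction of the standard t-structure *)

Section Restriction.
Variable R : pzRingType.
Implicit Types A B P X Y Z : complex R.

(** * Stability of the two subcategories under isomorphism and shift *)

Lemma Kminus_proj_iso X Y : disomorphic X Y -> Kminus_proj X -> Kminus_proj Y.
Proof.
move=> /disomorphic_sym XY [P [bP fP XP]]; exists P; split=> //.
exact: disomorphic_trans XY XP.
Qed.

Lemma Kminus_proj_shift X : Kminus_proj X -> Kminus_proj (shift X).
Proof.
move=> [P [[N PN] fP XP]]; exists (shift P).
split; [|by move=> i; apply: fP|exact: disomorphic_shift].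
by exists N => i iN x; apply: (PN (succz i)); rewrite succzE; lia.
Qed.

Lemma Kminus_proj_unshift X : Kminus_proj (shift X) -> Kminus_proj X.
Proof.
move=> [P [[N PN] fP XP]]; exists (unshift P).
split; [|by move=> i; apply: fP|].
  exists (N + 1) => i iN x; apply: (PN (predz i)).
  have -> : predz i = i - 1 by case: i {x iN} => [[|n]|n] /=; lia.
  by lia.
apply: disomorphic_trans (disomorphic_unshift XP).
exact/disomorphic_sym/disomorphic_unshift_shift.
Qed.

Lemma bounded_cohomology_iso X Y :
  disomorphic X Y -> bounded_cohomology X -> bounded_cohomology Y.
Proof.
by move=> XY [s zX]; exists s => i /zX; apply: iso_cohomology_zero.
Qed.

Lemma bounded_cohomology_shift X :
  bounded_cohomology (shift X) <-> bounded_cohomology X.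
Proof.
split=> [[s zX]|[s zX]].
  exists (map succz s) => i; have [j <-] := succz_surj i => js.
  by apply/cohomology_zero_shift/zX; apply: contraNN js; apply: map_f.
exists (map (fun i => i - 1) s) => i is_; apply/cohomology_zero_shift/zX.
apply: contraNN is_ => is_; apply/mapP; exists (succz i) => //.
by rewrite succzE addrK.
Qed.

(** Bounded cohomology is invariant under isomorphism, so it can be tested on [X] instead of its
    projective model. *)
Lemma Kminusb_projE X :
  Kminusb_proj X <-> Kminus_proj X /\ bounded_cohomology X.
Proof.
split=> [[P [bP fP hP XP]]|[[P [bP fP XP]] hX]].
  by split; [exists P|apply: bounded_cohomology_iso hP; apply: disomorphic_sym].
by exists P; split=> //; apply: bounded_cohomology_iso hX.
Qed.

(** * Reduction to the existence of truncation triangles inside the subcategory *)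

Definition truncation_triangle (U : complex R -> Prop) X : Prop :=
  exists (A B : complex R) (u : dhom A X) (v : dhom X B) (w : dhom B (shift A)),
    [/\ U A, U B, std_le0 A, std_ge0 (shift B) & distinguished u v w].

Lemma std_restricts (U : complex R -> Prop) :
  (forall X Y, disomorphic X Y -> U X -> U Y) ->
  (forall X, U (shift X) <-> U X) ->
  (forall X, U X -> truncation_triangle U X) ->
  t_restricts (@std_le0 R) (@std_ge0 R) U.
Proof.
move=> Uiso Ushift Utri; split.
- by move=> X [].
- by move=> X [].
- move=> X Y XY [leX UX]; split; last exact: Uiso XY UX.
  by move=> i i0; apply: iso_cohomology_zero XY (leX i i0).
- move=> X Y XY [geX UX]; split; last exact: Uiso XY UX.
  by move=> i i0; apply: iso_cohomology_zero XY (geX i i0).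
- move=> X [leX UX]; split; last exact/Ushift.
  by move=> i i0; apply/cohomology_zero_shift/leX; rewrite succzE; lia.
- move=> Y [/std_ge0_shift geY /Ushift UY]; split=> // i i0.
  by apply: geY; apply: ltW.
- by move=> X Y [leX _] _ [geY _] u; apply: std_orthogonal.
- move=> X /Utri [A [B [u [v [w [UA UB leA geB tri]]]]]].
  by exists A, B, u, v, w; split=> //; split=> //; apply/Ushift.
Qed.

(** The standard triangle of [f], with its middle term replaced along the isomorphism of [X] with
    [P]. *)
Lemma distinguished_cone A P X (f : chain_map A P) :
  disomorphic X P ->
  exists (u : dhom A X) (v : dhom X (cone f)) (w : dhom (cone f) (shift A)),
    distinguished u v w.
Proof.
move=> [b ib]; have [b' [b'b bb']] := ib.
exists (Dcomp b' (Dmap f)), (Dcomp (Dmap (cone_incl f)) b).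
exists (Dmap (cone_proj f)).
exists A, P, f, (did A), b, (did (cone f)); split.
  by split=> //; apply: dis_iso_id.
split.
- apply: deq_trans (deq_assoc _ _ _) _.
  apply: deq_trans (deq_comp bb' (deq_refl _)) _.
  exact: deq_trans (deq_idl _) (deq_sym (deq_idr _)).
- exact: deq_idl.
- apply: deq_trans (deq_sym (deq_idr _)).
  apply: deq_trans (deq_idl _); apply: deq_comp (deq_refl _).
  exact: deq_map.
Qed.

Lemma distinguished_iso_cone X Y Z (u : dhom X Y) (v : dhom Y Z)
    (w : dhom Z (shift X)) :
  distinguished u v w -> exists (A B : complex R) (f : chain_map A B),
    [/\ disomorphic X A, disomorphic Y B & disomorphic Z (cone f)].
Proof.
move=> [A [B [f [a [b [c [[ia ib ic] _]]]]]]].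
by exists A, B, f; split; [exists a|exists b|exists c].
Qed.

(** * Pieces of the long exact cohomology sequence of a cone *)

Lemma cone_H_inj A B (f : chain_map A B) i (x : A (succz i)) :
  cohomology_zero (cone f) i ->
  cocycle x -> coboundary (f (succz i) x) -> coboundary x.
Proof.
have [j ej] := succz_surj i; case: _ / ej x => x zC cx /coboundaryS [y fx].
(* Since [f x = d y], the pair [(x, -y)] is a cocycle of the cone; the first component of its
   primitive bounds [x] up to sign. *)
have [|[a b] /(congr1 fst) /= xa] := (@coboundaryS R (cone f) j (x, - y)).1.
  by apply: zC; rewrite /cocycle /= /cone_diff /= cx oppr0 linearN fx subrr.
by apply/coboundaryS; exists (- a); rewrite linearN.
Qed.

Lemma cone_H_surj A B (f : chain_map A B) i (y : B i) :
  cohomology_zero (cone f) i -> cocycle y ->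
  exists2 x : A i, cocycle x & coboundary (y - f i x).
Proof.
have [j ej] := succz_surj i; case: _ / ej y => y zC cy.
have [|[a b] e] := (@coboundaryS R (cone f) j (0, y)).1.
  by apply: zC; rewrite /cocycle /= /cone_diff /= !linear0 add0r cy.
exists a.
  by apply/eqP; rewrite -oppr_eq0 eq_sym; apply/eqP; exact: (congr1 fst e).
have -> : y = f (succz j) a + diff B j b := congr1 snd e.
by rewrite addrC addKr; apply: Coboundary.
Qed.

Lemma cone_cohomology_zero A B (f : chain_map A B) i :
  cohomology_zero A (succz i) -> cohomology_zero B i ->
  cohomology_zero (cone f) i.
Proof.
have [j ej] := succz_surj i; case: _ / ej => zA zB [a b] c0.
have ca : cocycle a.
  by apply/eqP; rewrite -oppr_eq0; apply/eqP; exact: (congr1 fst c0).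
have fab : f _ a + diff B _ b = 0 := congr1 snd c0.
have /coboundaryS [a' aE] := zA a ca.
(* With [a = d a'], adding the cone boundary of [(a', 0)] to [(a, b)] leaves [(0, b + f a')], a
   cocycle coming from [B]. *)
have /coboundaryS [b' bE] : coboundary (b + f (succz j) a').
  by apply: zB; rewrite /cocycle linearD -chain_funC -aE addrC.
apply/coboundaryS; exists (- a', b').
by rewrite /= /cone_diff /= !linearN opprK -aE -bE addrC addrK.
Qed.

(** * From coherence to truncation triangles, without and with bounded cohomology *)

Lemma coherent_restricts : right_coherent R ->
  t_restricts (@std_le0 R) (@std_ge0 R) (@Kminus_proj R).
Proof.
move=> cohR; apply: std_restricts => [X Y|X|X].
- exact: Kminus_proj_iso.
- by split; [apply: Kminus_proj_unshift|apply: Kminus_proj_shift].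
move=> [P [[N PN] fP XP]].
have [u [v [w tri]]] := distinguished_cone (cover_map cohR fP) XP.
exists (cover cohR fP), (cone (cover_map cohR fP)), u, v, w.
split=> //; [| |exact: std_le0_cover|exact: std_ge0_cone_cover].
  exists (cover cohR fP); split; last exact: disomorphic_refl.
    by exists 0 => i i0 x; apply: cover_eq0.
  exact: fgproj_cover.
exists (cone (cover_map cohR fP)); split; last exact: disomorphic_refl.
  (* In degree [i] the cone consists of the covering term of degree [i + 1] and of [P i]. *)
  exists (Num.max 0 N) => i iN [a p]; congr (_, _); last by apply: PN; lia.
  by apply: cover_eq0; rewrite succzE; lia.
by move=> i; apply: fgproj_pair; [apply: fgproj_cover|apply: fP].
Qed.

Lemma restricts_bounded :
  t_restricts (@std_le0 R) (@std_ge0 R) (@Kminus_proj R) ->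
  t_restricts (@std_le0 R) (@std_ge0 R) (@Kminusb_proj R).
Proof.
move=> tK; apply: std_restricts => [X Y XY|X|X].
- move=> /Kminusb_projE [KX bX]; apply/Kminusb_projE.
  by split; [apply: Kminus_proj_iso KX|apply: bounded_cohomology_iso bX].
- split=> /Kminusb_projE [KX bX]; apply/Kminusb_projE.
    by split; [apply: Kminus_proj_unshift|apply/bounded_cohomology_shift].
  by split; [apply: Kminus_proj_shift|apply/bounded_cohomology_shift].
move=> /Kminusb_projE [KX bX].
have [A [B [u [v [w [[leA KA] KB [geB _] tri]]]]]] := t_triangle tK KX.
exists A, B, u, v, w.
have [A' [X' [f [AA XX BC]]]] := distinguished_iso_cone tri.
have [s zX] := bounded_cohomology_iso XX bX.
(* In degrees [i <= 0], [H^i(A')] embeds in [H^i(X')] because the cone has no cohomology in degree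
   [i - 1]. *)
have zA i : i \notin s -> cohomology_zero A' i.
  move=> si; case: (lerP i 0) => i0.
    2: exact: iso_cohomology_zero AA (leA i i0).
  have := zX i si; have [j ej] := succz_surj i.
  case: _ / ej i0 {si} => j0 zXj x cx.
  apply: (cone_H_inj (f := f)) => //; last by apply: zXj; apply: cocycle_map.
  apply: iso_cohomology_zero BC _; apply: (std_ge0_shift B).1 => //.
  by move: j0; rewrite succzE; lia.
have bA : bounded_cohomology A.
  by apply: bounded_cohomology_iso (disomorphic_sym AA) _; exists s.
have bB : bounded_cohomology B.
  apply: bounded_cohomology_iso (disomorphic_sym BC) _.
  (* [H^i] of the cone lies between [H^i(X')] and [H^(i+1)(A')]; the second list accounts for the
     latter. *)
  exists (s ++ map (fun i => i - 1) s) => i.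
  rewrite mem_cat negb_or => /andP [si si'].
  apply: cone_cohomology_zero (zX i si); apply: zA; apply: contraNN si' => si'.
  by apply/mapP; exists (succz i) => //; rewrite succzE addrK.
by split=> //; apply/Kminusb_projE.
Qed.

(** * From truncation triangles back to coherence *)

(** A projective model [P] of [X] is exact in positive degrees and bounded above, so it splits
    there. The 0-cocycles are then a summand of [P 0], generated by the images of its generators. *)
Lemma fg_cohomology_of_le0 X : Kminus_proj X -> std_le0 X -> fg_cohomology X 0.
Proof.
move=> [P [[N PN] fP XP]] leX.
apply: iso_fg_cohomology (disomorphic_sym XP) _.
have leP : std_le0 P by move=> i i0; apply: iso_cohomology_zero XP (leX i i0).
(* Descending induction on the degree: the cocycles of [P] in degree [i >= 0]
   are the image of an idempotent [r], as [P i] maps onto the projective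
   summand of cocycles in degree [i + 1]. *)
have retraction (n : nat) (i : int) : 0 <= i -> N - i <= n%:Z ->
  exists r : {linear P i -> P i},
    (forall x, cocycle (r x)) /\ (forall x, cocycle x -> r x = x).
  elim: n i => [|n IHn] i i0 iN.
    (* Here [P (i + 1) = 0], so every element of degree [i] is a cocycle and the identity serves. *)
    have : N < succz i by rewrite succzE; lia.
    move=> /PN P0; exists idfun; split=> // x; exact: P0.
  have [|| r [cr rK]] := IHn (succz i); [rewrite succzE; lia..|].
  (* Adding the complement of the cocycles makes [p] onto all of [P (i + 1)],
     so projectivity applies without forming the submodule of cocycles. *)
  pose p := (diff P i \o fst) \+ ((idfun \- r) \o snd)
    : {linear (P i * P (succz i))%type -> P (succz i)}.
  have psurj y : exists a, p a = y.
    (* The cocycle [r y] has positive degree, hence [r y = d x], and [y = d x + (y - r y)]. *)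
    have /coboundaryS [x xE] : coboundary (r y).
      by apply: leP => //; rewrite succzE; lia.
    by exists (x, y); rewrite /= -xE addrC subrK.
  have [_ proj] := fP (succz i).
  have [h ph] := proj _ _ p idfun psurj.
  (* Apply [r] to [p (h y) = y]: it kills the image of [1 - r] and fixes the cocycles [d (h y).1]
     and [y]. *)
  have dh y : cocycle y -> diff P i (h y).1 = y.
    move=> cy; have /= := congr1 r (ph y); rewrite linearD linearB.
    by rewrite (rK (r _)) // subrr addr0 !rK // /cocycle diffK.
  (* Subtracting from [x] the chosen primitive of [d x] leaves a cocycle, and changes nothing if
     [d x = 0]. *)
  exists (idfun \- (fst \o h \o diff P i)); split=> x /=.
    by rewrite /cocycle linearB dh ?subrr // /cocycle diffK.
  by move=> cx; rewrite cx (linear0 h) /= subr0.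
have [] := retraction `|N|%N 0 _ _ => //; first lia.
move=> r [cr rK]; have [[n [g [_ gen]]] _] := fP 0.
exists n, (fun k => r (g k)); split=> // x cx.
have [c xE] := gen x I; exists c.
have -> : \sum_(k < n) c k *: r (g k) = x.
  rewrite -[RHS](rK _ cx) {1}xE linear_sum.
  by apply: eq_bigr => k _; rewrite linearZ.
by rewrite subrr; apply: coboundary0.
Qed.

(** * Kernels as degree 0 cohomology of two-term complexes *)

Section TwoTerm.
Variables (P Q : rmodType R) (f : {linear P -> Q}).

Definition two_term_obj (i : int) : rmodType R :=
  match i with
  | Posz 0 => P
  | Posz 1 => Q
  | _ => 'rV[R^c]_0
  end.

Definition two_term_diff (i : int) :
    {linear two_term_obj i -> two_term_obj (succz i)} :=
  match i return {linear two_term_obj i -> two_term_obj (succz i)} with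
  | Posz 0 => f
  | Posz _.+1 => \0
  | Negz _ => \0
  end.

Lemma two_term_diffK i (x : two_term_obj i) :
  two_term_diff (succz i) (two_term_diff i x) = 0.
Proof. by move: x; case: i => [[|n]|[|n]] x //=; rewrite linear0. Qed.

Definition two_term : complex R := Complex two_term_diffK.

Lemma two_term_eq0 i (x : two_term i) : i != 0 -> i != 1 -> x = 0.
Proof. by move: x; case: i => [[|[|n]]|n] // x _ _; apply/rowP => -[]. Qed.

Lemma Kminusb_two_term : fgproj P -> fgproj Q -> Kminusb_proj two_term.
Proof.
move=> fP fQ; apply/Kminusb_projE; split.
  exists two_term; split; last exact: disomorphic_refl.
    by exists 1 => i i1 x; apply: two_term_eq0; lia.
  by move=> [[|[|n]]|n] //=; apply: fgproj_free.
exists [:: 0; 1] => i; rewrite !inE negb_or => /andP [i0 i1] x _.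
by rewrite (two_term_eq0 x i0 i1); apply: coboundary0.
Qed.

Lemma fg_cohomology_two_term :
  fg_cohomology two_term 0 -> fg_submodule (fun x : P => f x = 0).
Proof.
move=> [n [g [cg gen]]]; exists n, g; split=> // x /gen [c b]; exists c.
(* The differential out of degree -1 is zero, so cohomologous 0-cocycles are equal. *)
have /(@coboundaryS R two_term (Negz 0)) [y /= xE] := b.
by apply/eqP; rewrite -subr_eq0; apply/eqP; rewrite xE.
Qed.

End TwoTerm.

(** For the truncation triangle of [two_term f], exactness at [H^0] and the vanishing of [H^0] of
    the cone make [H^0] of the lower truncation map onto the kernel of [f]. *)
Lemma restricts_coherent :
  t_restricts (@std_le0 R) (@std_ge0 R) (@Kminusb_proj R) -> right_coherent R.
Proof.
move=> tK P Q f fP fQ; apply: fg_cohomology_two_term.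
have [A [B [u [v [w [[leA KA] _ [geB _] tri]]]]]] :=
  t_triangle tK (Kminusb_two_term f fP fQ).
have [A' [X' [g [AA XX BC]]]] := distinguished_iso_cone tri.
apply: iso_fg_cohomology (disomorphic_sym XX) _.
have [KA' _] := (Kminusb_projE A).1 KA.
have [n [a [ca gen]]] := iso_fg_cohomology AA (fg_cohomology_of_le0 KA' leA).
exists n, (fun k => g 0 (a k)); split=> [k|y cy]; first exact: cocycle_map.
have zC : cohomology_zero (cone g) 0.
  by apply: iso_cohomology_zero BC _; apply: (std_ge0_shift B).1.
have [x cx bx] := cone_H_surj zC cy; have [c b] := gen x cx; exists c.
rewrite -(subrK (g 0 x) y) -addrA; apply: coboundaryD => //.
have -> : \sum_(k < n) c k *: g 0 (a k) = g 0 (\sum_(k < n) c k *: a k).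
  by rewrite linear_sum; apply: eq_bigr => k _; rewrite linearZ.
by rewrite -linearB; apply: coboundary_map.
Qed.

End Restriction.

Theorem corollary1p2 (R : pzRingType) :
  [<-> right_coherent R;
       t_restricts (@std_le0 R) (@std_ge0 R) (@Kminus_proj R);
       t_restricts (@std_le0 R) (@std_ge0 R) (@Kminusb_proj R)].
Proof.
tfae.
- exact: coherent_restricts.
- exact: restricts_bounded.
- exact: restricts_coherent.
Qed.
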